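(* Let $n\ge 1$ and let $N$ be a multiplicative, unitarily invariant, self-adjoint norm on $\mathbb{M}_n$. Let $X,Y\in\mathbb{M}_n$ with $Y=[y_{ij}]$ positive definite. Then $$\omega_N(X\circ Y)\le \max_i y_{ii}\;\omega_N(X).$$
   Context: $\mathbb{M}_n$ is the algebra of $n\times n$ complex matrices, and $X\circ Y=[x_{ij}y_{ij}]$ is the Hadamard product of $X=[x_{ij}]$ and $Y=[y_{ij}]$. A norm $N$ on $\mathbb{M}_n$ is multiplicative if $N(XY)\le N(X)N(Y)$ (ordinary matrix product) for all $X,Y\in\mathbb{M}_n$; unitarily invariant if $N(UXV)=N(X)$ for all $X\in\mathbb{M}_n$ and all unitary $U,V\in\mathbb{M}_n$; self-adjoint if $N(X^* )=N(X)$ for all $X$. With $\operatorname{Re}(X)=\frac{X+X^*}{2}$, the generalized numerical radius induced by $N$ is $\omega_N(X)=\sup_{\theta\in\mathbb{R}}N(\operatorname{Re}(e^{i\theta}X))$. *)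

(* Defs.v *)
From mathcomp Require Import all_boot all_order all_algebra.
From mathcomp Require Import complex.
From mathcomp Require Import all_classical all_reals all_analysis.

Set Implicit Arguments.
Unset Strict Implicit.
Unset Printing Implicit Defensive.

Import Order.TTheory GRing.Theory Num.Theory.
Local Open Scope classical_set_scope.
Local Open Scope ring_scope.
Local Open Scope sesquilinear_scope.
Local Open Scope complex_scope.

Section Defs.
Context {R : realType}.
Local Notation C := R[i].

Definition hadamard n (X Y : 'M[C]_n) : 'M[C]_n :=
  \matrix_(i, j) (X i j * Y i j).

(* [0 < z] in [C] means that [z] is real and positive. *)
Definition posdefmx n (Y : 'M[C]_n) : Prop :=
  Y \is hermsymmx /\
  forall x : 'cV[C]_n, x != 0 -> 0 < (x ^t* *m Y *m x) 0 0.

(* A norm on the complex vector space of matrices; [Normc.normc c : R] is the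
   modulus of [c]. *)
Record is_mxnorm n (N : 'M[C]_n -> R) : Prop := IsMxNorm {
  mxnorm_ge0 : forall X, 0 <= N X;
  mxnorm_eq0 : forall X, N X = 0 -> X = 0;
  mxnormZ : forall (c : C) X, N (c *: X) = Normc.normc c * N X;
  ler_mxnormD : forall X Y, N (X + Y) <= N X + N Y
}.

Definition mxnorm_multiplicative n (N : 'M[C]_n -> R) : Prop :=
  forall X Y, N (X *m Y) <= N X * N Y.

Definition mxnorm_unitarily_invariant n (N : 'M[C]_n -> R) : Prop :=
  forall X U V, U \is unitarymx -> V \is unitarymx -> N (U *m X *m V) = N X.

Definition mxnorm_selfadjoint n (N : 'M[C]_n -> R) : Prop :=
  forall X, N (X ^t*) = N X.

Definition mxReal_part n (X : 'M[C]_n) : 'M[C]_n := 2%:R^-1 *: (X + X ^t*).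

Definition expi (t : R) : C := cos t +i* sin t.

(* The supremum is taken in [R], where [sup] is meaningful only for nonempty
   sets that are bounded above; see [gen_num_radius_has_sup]. *)
Definition gen_num_radius n (N : 'M[C]_n -> R) (X : 'M[C]_n) : R :=
  sup [set N (mxReal_part (expi t *: X)) | t in [set: R]].

(* The diagonal entries of a Hermitian matrix are real; the unit of the
   iterated maximum is itself one of them. *)
Definition max_diag n (n_gt0 : (0 < n)%N) (Y : 'M[C]_n) : R :=
  let i0 := Ordinal n_gt0 in
  \big[Num.max/complex.Re (Y i0 i0)]_(i < n) complex.Re (Y i i).

Lemma normc_expi t : Normc.normc (expi t) = 1.
Proof. by rewrite /Normc.normc /expi cos2Dsin2 sqrtr1. Qed.

Lemma gen_num_radius_has_sup n (N : 'M[C]_n -> R) (X : 'M[C]_n) :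
  is_mxnorm N -> has_sup [set N (mxReal_part (expi t *: X)) | t in [set: R]].
Proof.
move=> [N0 _ NZ ND]; split; first by exists (N (mxReal_part (expi 0 *: X))), 0.
exists (Normc.normc (2%:R^-1 : C) * (N X + N (X ^t*))) => _ [t _ <-].
rewrite /mxReal_part NZ; apply: ler_wpM2l.
  by case: (2%:R^-1 : C) => a b; exact: sqrtr_ge0.
apply: (le_trans (ND _ _)); rewrite linearZ /= map_mxZ !NZ normc_expi mul1r.
suff -> : Normc.normc (Num.conj (expi t)) = 1 by rewrite mul1r.
by rewrite /Normc.normc /= sqrrN cos2Dsin2 sqrtr1.
Qed.

End Defs.

(* Main.v *)
Require Import Defs.
From mathcomp Require Import all_boot all_order all_algebra all_fingroup.
From mathcomp Require Import complex ring.
From mathcomp Require Import all_classical all_reals all_analysis.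
(* Re-imported so that [set0], [subset_trans], ... are those of finite sets. *)
From mathcomp Require Import fintype finset.
Import Order.TTheory GRing.Theory Num.Theory.
Local Open Scope ring_scope.
Local Open Scope sesquilinear_scope.

(** Since [Y] is Hermitian, [Re (e^(it) X o Y) = Re (e^(it) X) o Y], so it is
    enough to bound [N (H o Y)] by [max y_ii * N H] for Hermitian [H]. Write
    [Y = D C D] with [D = diag (sqrt y_ii)] and [C] of unit diagonal. Then
    [H o Y = D (H o C) D], and a real diagonal matrix with entries in [[-m, m]]
    is [m] times the mean of two unitary ones, so [D] costs a factor
    [sqrt (max y_ii)] on each side. If [u_j] and [v_i] are orthonormal
    eigenbases of [H] and of [H o C], the eigenvalues of [H o C] are those of
    [H] multiplied by the matrix [v_i^* (u_j u_j^* o C) v_i], which is doubly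
    stochastic. By Birkhoff's theorem, obtained from Hall's marriage theorem,
    such a matrix does not increase [N] on diagonal matrices, because [N] is
    convex and permutation invariant there. *)

(** * Hall's marriage theorem *)

Definition neighbours {T : finType} (e : rel T) (J : {set T}) : {set T} :=
  [set j | [exists i in J, e i j]].

(** Strong induction on [#|A|]. If a nonempty proper subset [J] of [A] is tight, [J] and [A :\: J]
    are matched separately; otherwise every such subset has a spare neighbour, and any one edge can
    be removed. *)
Lemma hall_matching {T : finType} (e : rel T) (A B : {set T}) :
  (forall J : {set T}, J \subset A -> (#|J| <= #|neighbours e J :&: B|)%N) ->
  exists f : T -> T, {in A &, injective f} /\
    {in A, forall i, e i (f i) && (f i \in B)}.
Proof.
have [k] := ubnP #|A|; elim: k A B => // k IHk A B /ltnSE leAk hallA.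
have [A0|[a aA]] := set_0Vmem A.
  by exists id; split => [i j|i]; rewrite A0 inE.
pose tight (J : {set T}) := [&& J \subset A, J != set0, J != A &
  (#|J| == #|neighbours e J :&: B|)%N].
have [J /and4P[JA J0 JneA /eqP tJ]|noJ] := pickP tight.
  have propJ : J \proper A by rewrite properEneq JneA JA.
  have [|K KJ|f [finj fP]] := IHk J B.
  - exact: leq_trans (proper_card propJ) leAk.
  - by apply: hallA; exact: subset_trans KJ JA.
  have [||h [hinj hP]] := IHk (A :\: J) (B :\: neighbours e J).
  - apply: leq_trans leAk; rewrite cardsD (setIidPr JA) ltn_subrL.
    by rewrite card_gt0 J0 card_gt0; apply/set0Pn; exists a.
  - move=> K KAJ.
    have dKJ : [disjoint K & J].
      by move: KAJ; rewrite subsetD => /andP[].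
    (* Hall's condition for [K :|: J], minus the equality for the tight [J], gives it for [K]
       outside the neighbours of [J]. *)
    have : (#|K :|: J| <= #|neighbours e (K :|: J) :&: B|)%N.
      apply: hallA; rewrite subUset JA andbT.
      by apply: subset_trans KAJ _; exact: subsetDl.
    rewrite cardsU disjoint_setI0 // cards0 subn0.
    have -> : neighbours e (K :|: J) :&: B =
        (neighbours e J :&: B) :|: (neighbours e K :&: (B :\: neighbours e J)).
      apply/setP => j; rewrite !inE.
      have -> : [exists i in K :|: J, e i j] =
          [exists i in K, e i j] || [exists i in J, e i j].
        apply/existsP/orP => [[i /andP[]]|].
          by rewrite inE => /orP[] iK eij; [left|right]; apply/existsP;
            exists i; rewrite iK.
        by case=> /existsP[i /andP[iK eij]]; exists i; rewrite inE iK ?orbT.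
      by case: [exists i in K, _]; case: [exists i in J, _]; case: (j \in B).
    rewrite cardsU => /leq_trans /(_ (leq_subr _ _)).
    by rewrite -tJ addnC leq_add2l.
  exists (fun i => if i \in J then f i else h i); split.
    have sep i j : i \in A -> j \in A -> i \in J -> j \notin J -> f i <> h j.
      move=> iA jA iJ jJ eq_fh.
      have /hP/andP[_] : j \in A :\: J by rewrite inE jJ.
      rewrite inE -eq_fh => /andP[/negP[]]; rewrite inE; apply/existsP.
      by exists i; rewrite iJ; case/andP: (fP i iJ).
    move=> i j iA jA; case: ifPn => iJ; case: ifPn => jJ.
    - exact: finj.
    - by move/sep => /(_ iA jA iJ jJ).
    - by move/esym/sep => /(_ jA iA jJ iJ).
    - by apply: hinj; rewrite inE ?iJ ?jJ.
  move=> i iA; case: ifPn => iJ; first exact: fP.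
  have /hP/andP[-> ] : i \in A :\: J by rewrite inE iJ.
  by rewrite inE => /andP[].
(* No tight subset: [a] is matched with an arbitrary neighbour [b]. *)
have [b] : exists b, b \in neighbours e [set a] :&: B.
  apply/set0Pn; rewrite -card_gt0; apply: leq_trans (hallA [set a] _).
    by rewrite cards1.
  by rewrite sub1set.
rewrite !inE => /andP[/existsP[a' /andP[]]]; rewrite inE => /eqP-> eab bB.
have [||f [finj fP]] := IHk (A :\ a) (B :\ b).
- by move: leAk; rewrite (cardsD1 a) aA.
- move=> J JAa; have JA : J \subset A.
    by apply: subset_trans JAa _; rewrite subD1set.
  have [->|J0] := eqVneq J set0; first by rewrite cards0.
  have JneA : J != A.
    by apply: contraTneq JAa => ->; rewrite subsetD1 aA andbF.
  (* The strict inequality absorbs the loss of [b]. *)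
  have : (#|J| < #|neighbours e J :&: B|)%N.
    rewrite ltn_neqAle hallA // andbT; apply/negP => tJ.
    by have := noJ J; rewrite /tight JA J0 JneA tJ.
  move/leq_trans => /(_ _ _)/ltnSE; apply.
  rewrite (cardsD1 b) -addn1 addnC leq_add ?leq_b1 // subset_leq_card //.
  by apply/subsetP => j; rewrite !inE => /and3P[-> -> ->].
exists (fun i => if i == a then b else f i); split.
  have sep i : i \in A -> i != a -> f i <> b.
    move=> iA ia eq_fb; have /fP/andP[_] : i \in A :\ a by rewrite !inE ia.
    by rewrite !inE eq_fb eqxx.
  move=> i j iA jA; case: ifPn => [/eqP->|ia]; case: ifPn => [/eqP->|ja] //.
  - by move/esym/sep => /(_ jA ja).
  - by move/sep => /(_ iA ia).
  - by apply: finj; rewrite !inE ?ia ?ja.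
move=> i iA; case: ifPn => [/eqP->|ia]; first by rewrite eab.
have /fP/andP[->] : i \in A :\ a by rewrite !inE ia.
by rewrite !inE => /andP[].
Qed.

(** * Birkhoff's theorem for sublinear functions *)

(** Hall's condition comes from double counting: the rows in [J] have total mass [r * #|J|], all of
    it in the columns neighbouring [J], whose total mass is [r] times their number. *)
Lemma const_sums_perm_gt0 {R : realFieldType} {n} {S : 'M[R]_n} {r : R} :
  0 < r -> (forall i j, 0 <= S i j) ->
  (forall i, \sum_j S i j = r) -> (forall j, \sum_i S i j = r) ->
  exists s : {perm 'I_n}, forall i, 0 < S i (s i).
Proof.
move=> r0 S0 Srow Scol; pose e i j := 0 < S i j.
have [J _|f [finj fP]] := hall_matching e [set: 'I_n] [set: 'I_n].
  rewrite setIT -(ler_nat R) -(ler_pM2l r0) !mulr_natr -!sumr_const.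
  rewrite -(eq_bigr _ (fun i _ => Srow i)) -(eq_bigr _ (fun j _ => Scol j)).
  rewrite [leRHS]exchange_big /= [leRHS](bigID (mem J)) /=.
  rewrite -[leLHS]addr0; apply: lerD; last by do 2!apply: sumr_ge0 => ? _.
  apply: ler_sum => i iJ; rewrite (bigID (mem (neighbours e J))) /=.
  rewrite -[leRHS]addr0; apply: lerD => //; rewrite big1 // => j.
  rewrite inE => /existsPn/(_ i); rewrite iJ /= /e lt0r S0 andbT negbK.
  exact: eqP.
have injf : injective f by move=> i j; apply: finj; rewrite inE.
by exists (perm injf) => i; rewrite permE; case/andP: (fP i (in_setT i)).
Qed.

(* Birkhoff's theorem in the form needed here: peeling off a positive multiple
   of a permutation matrix leaves a matrix of the same kind with more zeros. *)
Lemma sublinear_doubly_stochastic {R : rcfType} {n} (g : 'rV[R[i]]_n -> R)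
    (gD : forall x y, g (x + y) <= g x + g y)
    (gZ : forall (t : R) x, 0 <= t -> g (real_complex R t *: x) = t * g x)
    (gP : forall (s : {perm 'I_n}) x, g (x *m perm_mx s) = g x)
    (S : 'M[R]_n) (r : R) (x : 'rV[R[i]]_n) :
  0 <= r -> (forall i j, 0 <= S i j) ->
  (forall i, \sum_j S i j = r) -> (forall j, \sum_i S i j = r) ->
  g (x *m map_mx (real_complex R) S) <= r * g x.
Proof.
pose supp (S : 'M[R]_n) := [set ij : 'I_n * 'I_n | S ij.1 ij.2 != 0].
have [k] := ubnP #|supp S|; elim: k S r => // k IHk S r /ltnSE leSk r0 S0 Srow Scol.
have [r_eq0|rN0] := eqVneq r 0.
  have -> : S = 0.
    apply/matrixP => i j; rewrite mxE; apply/eqP.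
    have := Srow i; rewrite r_eq0 => /eqP.
    by rewrite psumr_eq0 // => /allP/(_ j); rewrite mem_index_enum => /(_ isT).
  rewrite map_mx0 mulmx0 r_eq0 -(scale0r (0 : 'rV_n)).
  by rewrite -(rmorph0 (real_complex R)) gZ // !mul0r.
have r_gt0 : 0 < r by rewrite lt0r rN0.
have [s sP] := const_sums_perm_gt0 r_gt0 S0 Srow Scol.
(* The minimum below needs an index, so [n = 0] is settled apart. *)
have [i0 _|n0] := pickP (@predT 'I_n); last first.
  have -> : x *m map_mx (real_complex R) S = real_complex R r *: x.
    by apply/rowP => j; have := n0 j.
  by rewrite gZ.
(* The least entry of [S] along [s] is the largest multiple of [P] that can be subtracted with all
   entries staying nonnegative; the entry attaining it becomes zero. *)
case: (arg_minP (fun i => S i (s i)) (isT : predT i0)) => i1 _ tmin.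
pose t := S i1 (s i1); pose P : 'M[R]_n := perm_mx s.
have Prow i : \sum_j P i j = 1.
  rewrite (bigD1 (s i)) //= big1 => [|j /negPf sij]; rewrite !mxE ?eqxx ?addr0 //.
  by rewrite eq_sym sij.
have Pcol j : \sum_i P i j = 1.
  rewrite (bigD1 (s^-1 j)%g) //= big1 => [|i sij]; rewrite !mxE ?permKV ?eqxx ?addr0 //.
  by case: (s i =P j) sij => // <-; rewrite permK eqxx.
have S'ge0 i j : 0 <= (S - t *: P) i j.
  rewrite !mxE; case: eqP => [<-|_]; rewrite ?mulr1 ?mulr0 ?subr0 //.
  by rewrite subr_ge0 tmin.
have S'row i : \sum_j (S - t *: P) i j = r - t.
  rewrite -[in RHS](Srow i) -[t in RHS]mulr1 -(Prow i) mulr_sumr -sumrB.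
  by apply: eq_bigr => j _; rewrite !mxE.
have S'col j : \sum_i (S - t *: P) i j = r - t.
  rewrite -[in RHS](Scol j) -[t in RHS]mulr1 -(Pcol j) mulr_sumr -sumrB.
  by apply: eq_bigr => i _; rewrite !mxE.
have t_gt0 : 0 < t := sP i1.
have rt_ge0 : 0 <= r - t by rewrite -(S'row i1) sumr_ge0.
have lt_supp : (#|supp (S - t *: P)%R| < k)%N.
  apply: leq_trans leSk; apply: proper_card; apply/properP; split.
    (* Zeros of [S] persist: there the new entry is [- t * P i j], which is both nonpositive and
       nonnegative. *)
    apply/subsetP => -[i j]; rewrite !inE /=; apply: contraNneq => Sij0.
    have := S'ge0 i j; rewrite !mxE Sij0 sub0r oppr_ge0 => le0.
    by rewrite eq_le oppr_ge0 le0 oppr_le0 mulr_ge0 ?ler0n // ltW.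
  exists (i1, s i1); rewrite !inE /= ?(gt_eqF t_gt0) //.
  by rewrite !mxE eqxx mulr1 subrr eqxx.
have -> : x *m map_mx (real_complex R) S =
    x *m map_mx (real_complex R) (S - t *: P) + real_complex R t *: (x *m perm_mx s).
  by rewrite map_mxB map_mxZ /P map_perm_mx mulmxBr -scalemxAr subrK.
apply: le_trans (gD _ _) _; rewrite gZ ?(ltW t_gt0) // gP.
rewrite -lerBrDr -mulrBl.
exact: IHk lt_supp rt_ge0 S'ge0 S'row S'col.
Qed.

(** * Unitary matrices *)

Lemma perm_mx_unitary (C : numClosedFieldType) n (s : {perm 'I_n}) :
  perm_mx s \is @unitarymx C n n.
Proof.
by apply/unitarymxP; rewrite tr_perm_mx map_perm_mx -perm_mxM mulgV perm_mx1.
Qed.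

Lemma diag_mx_unitary (C : numClosedFieldType) n (u : 'rV[C]_n) :
  (forall i, `|u 0 i| = 1) -> diag_mx u \is unitarymx.
Proof.
move=> u1; apply/unitarymxP; rewrite tr_diag_mx map_diag_mx mulmx_diag.
rewrite -diag_const_mx; congr diag_mx; apply/rowP => i.
by rewrite !mxE -normCK u1 expr1n.
Qed.

(** A one-sided inverse of a square matrix is two-sided, so the columns are orthonormal as well as
    the rows. *)
Lemma unitarymx_col_dot {C : numClosedFieldType} {n} {V : 'M[C]_n} k m :
  V \is unitarymx -> \sum_i V i k * (V i m)^* = (k == m)%:R.
Proof.
move=> /unitarymxP /mulmx1C /matrixP /(_ m k); rewrite !mxE eq_sym => <-.
by apply: eq_bigr => i _; rewrite !mxE mulrC.
Qed.

Lemma unitarymx_row_dot {C : numClosedFieldType} {n} {V : 'M[C]_n} i j :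
  V \is unitarymx -> \sum_k V i k * (V j k)^* = (i == j)%:R.
Proof.
move=> /unitarymxP /matrixP /(_ i j); rewrite !mxE => <-.
by apply: eq_bigr => k _; rewrite !mxE.
Qed.

(** A real [c] in [[-1, 1]] is the mean of the conjugate unit complex numbers with real part [c];
    this is applied to each [d 0 i / m]. *)
Lemma diag_mx_scaled_unitary_mean {R : rcfType} {n} {d : 'rV[R]_n} {m : R} :
  0 < m -> (forall i, `|d 0 i| <= m) ->
  exists U U' : 'M[R[i]]_n, [/\ U \is unitarymx, U' \is unitarymx &
    diag_mx (map_mx (real_complex R) d) = real_complex R (m / 2) *: (U + U')].
Proof.
move=> m_gt0 dm; pose c i := d 0 i / m; pose s i := Num.sqrt (1 - c i ^+ 2).
have sqr_s i : s i ^+ 2 = 1 - c i ^+ 2.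
  rewrite sqr_sqrtr // subr_ge0 -real_normK ?num_real // exprn_ile1 //.
  by rewrite normrM normfV (gtr0_norm m_gt0) ler_pdivrMr // mul1r.
pose u (b : bool) : 'rV_n := \row_i Complex (c i) ((-1) ^+ b * s i).
have u_unitary b : diag_mx (u b) \is unitarymx.
  apply: diag_mx_unitary => i; rewrite mxE normc_def /= (_ : (_ * s i) ^+ 2 = s i ^+ 2).
    by rewrite sqr_s addrC subrK sqrtr1.
  by rewrite exprMn sqrr_sign mul1r.
exists (diag_mx (u false)), (diag_mx (u true)); split=> //.
rewrite -raddfD -linearZ /=; congr diag_mx; apply/rowP => i; rewrite !mxE.
rewrite expr0 expr1 mul1r mulN1r.
have -> : Complex (c i) (s i) + Complex (c i) (- s i) = real_complex R (2 * c i).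
  by apply/eqP; rewrite eq_complex /= subrr mulr2n mulrDl mul1r !eqxx.
by rewrite -rmorphM mulrA divfK ?pnatr_eq0 // mulrC divfK ?gt_eqF.
Qed.

(** * Hermitian and positive definite matrices *)

Lemma conj_real_complex (R : rcfType) (x : R) :
  (real_complex R x)^* = real_complex R x.
Proof. by apply/CrealP; rewrite complex_real. Qed.

Lemma posdefmx_diag_gt0 {R : realType} {n} {Y : 'M[R[i]]_n} i :
  posdefmx Y -> 0 < Y i i.
Proof.
case=> _ /(_ (delta_mx i 0)); rewrite trmx_delta map_delta_mx -rowE -colE !mxE.
apply; apply/eqP => /matrixP/(_ i 0).
by rewrite !mxE !eqxx => /eqP; rewrite oner_eq0.
Qed.

Lemma max_diag_gt0 {R : realType} {n} (n_gt0 : (0 < n)%N) {Y : 'M[R[i]]_n} :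
  posdefmx Y -> 0 < max_diag n_gt0 Y.
Proof.
move=> /(posdefmx_diag_gt0 (Ordinal n_gt0)); rewrite ltcE => /andP[_ Y0].
by apply: lt_le_trans Y0 _; exact: le_bigmax_cond.
Qed.

Lemma hadamard_hermitian {R : realType} {n} {H C : 'M[R[i]]_n} :
  H \is hermsymmx -> C \is hermsymmx -> hadamard H C \is hermsymmx.
Proof.
move=> /is_hermitianmxP; rewrite expr0 scale1r => /matrixP hH.
move=> /is_hermitianmxP; rewrite expr0 scale1r => /matrixP hC.
apply/is_hermitianmxP; rewrite expr0 scale1r; apply/matrixP => i j.
by rewrite !mxE hH hC !mxE rmorphM.
Qed.

Lemma mxReal_part_hermitian {R : realType} {n} (A : 'M[R[i]]_n) :
  mxReal_part A \is hermsymmx.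
Proof.
apply/is_hermitianmxP; rewrite expr0 scale1r; apply/matrixP => i j.
by rewrite !mxE rmorphM fmorphV rmorph_nat rmorphD /= conjCK addrC.
Qed.

Lemma mxReal_part_hadamard {R : realType} {n} (A Y : 'M[R[i]]_n) :
  Y \is hermsymmx -> mxReal_part (hadamard A Y) = hadamard (mxReal_part A) Y.
Proof.
move/is_hermitianmxP; rewrite expr0 scale1r => /matrixP hY.
apply/matrixP => i j; have := hY i j; rewrite !mxE => Yij.
by rewrite rmorphM /= -Yij; ring.
Qed.

(** * Estimates for unitarily invariant norms *)

Section UnitarilyInvariant.
Context {R : realType} {n : nat} {N : 'M[R[i]]_n -> R}.
Context (N_norm : is_mxnorm N) (N_unitary : mxnorm_unitarily_invariant N).
Local Notation toC := (real_complex R).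

Lemma mxnormZ_real (t : R) X : 0 <= t -> N (toC t *: X) = t * N X.
Proof.
move=> t0; rewrite (mxnormZ N_norm) /Normc.normc /= expr0n addr0.
by rewrite sqrtr_sqr ger0_norm.
Qed.

Lemma mxnorm_unitaryl U X : U \is unitarymx -> N (U *m X) = N X.
Proof.
move=> U1; rewrite -[RHS](N_unitary X U 1%:M) ?mulmx1 //.
by apply/unitarymxP; rewrite trmx1 map_mx1 mulmx1.
Qed.

Lemma mxnorm_unitaryr U X : U \is unitarymx -> N (X *m U) = N X.
Proof.
move=> U1; rewrite -[RHS](N_unitary X 1%:M U) ?mul1mx //.
by apply/unitarymxP; rewrite trmx1 map_mx1 mulmx1.
Qed.

Lemma ler_mxnorm_diagM (d : 'rV[R]_n) (m : R) X :
  0 < m -> (forall i, `|d 0 i| <= m) -> N (diag_mx (map_mx toC d) *m X) <= m * N X.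
Proof.
move=> m0 /(diag_mx_scaled_unitary_mean m0)[U [U' [U1 U'1 ->]]].
rewrite -scalemxAl mulmxDl mxnormZ_real; last by rewrite divr_ge0 ?ltW.
rewrite -mulrA ler_pM2l // mulrC ler_pdivrMr // mulrDr mulr1.
by apply: le_trans (ler_mxnormD N_norm _ _) _; rewrite !mxnorm_unitaryl.
Qed.

Lemma ler_mxnorm_Mdiag (d : 'rV[R]_n) (m : R) X :
  0 < m -> (forall i, `|d 0 i| <= m) -> N (X *m diag_mx (map_mx toC d)) <= m * N X.
Proof.
move=> m0 /(diag_mx_scaled_unitary_mean m0)[U [U' [U1 U'1 ->]]].
rewrite -scalemxAr mulmxDr mxnormZ_real; last by rewrite divr_ge0 ?ltW.
rewrite -mulrA ler_pM2l // mulrC ler_pdivrMr // mulrDr mulr1.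
by apply: le_trans (ler_mxnormD N_norm _ _) _; rewrite !mxnorm_unitaryr.
Qed.

Lemma mxnorm_spectral_diag A :
  A \is normalmx -> N A = N (diag_mx (spectral_diag A)).
Proof.
move=> /orthomx_spectralP {1}->.
rewrite invmx_unitary ?spectral_unitarymx // N_unitary ?spectral_unitarymx //.
by rewrite trmxC_unitary spectral_unitarymx.
Qed.

Lemma ler_mxnorm_diag_doubly_stochastic (x : 'rV[R[i]]_n) (S : 'M[R]_n) :
  (forall i j, 0 <= S i j) ->
  (forall i, \sum_j S i j = 1) -> (forall j, \sum_i S i j = 1) ->
  N (diag_mx (x *m map_mx toC S)) <= N (diag_mx x).
Proof.
move=> S0 Srow Scol; rewrite -[leRHS]mul1r.
apply: (sublinear_doubly_stochastic (fun y => N (diag_mx y))) => //.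
- by move=> y z; rewrite raddfD; exact: (ler_mxnormD N_norm).
- by move=> t y t0; rewrite linearZ /= mxnormZ_real.
(* Permuting [y] conjugates [diag_mx y] by a permutation matrix. Writing [s] as an inverse matches
   the form of [col_permE]. *)
- move=> s y; have [t ->] : exists t, s = (t^-1)%g by exists s^-1%g; rewrite invgK.
  have -> : diag_mx (y *m perm_mx t^-1) = perm_mx t *m diag_mx y *m perm_mx t^-1.
    rewrite -!col_permE -row_permE; apply/matrixP => i j.
    by rewrite !mxE (inj_eq perm_inj).
  by rewrite N_unitary ?perm_mx_unitary.
Qed.

Lemma ler_mxnorm_hadamard_correlation (H C : 'M[R[i]]_n) :
  H \is hermsymmx -> C \is hermsymmx ->
  (forall w : 'cV_n, 0 <= (w ^t* *m C *m w) 0 0) -> (forall i, C i i = 1) ->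
  N (hadamard H C) <= N H.
Proof.
move=> hH hC C_psd Cii; have hK := hadamard_hermitian hH hC.
have nH := hermitian_normalmx hH; have nK := hermitian_normalmx hK.
rewrite (mxnorm_spectral_diag H) // (mxnorm_spectral_diag (hadamard H C)) //.
set K := hadamard H C in nK *; set l := spectral_diag H; set mu := spectral_diag K.
pose U := spectralmx H; pose V := spectralmx K.
have U1 : U \is unitarymx := spectral_unitarymx H.
have V1 : V \is unitarymx := spectral_unitarymx K.
(* [T j i] is [w^* C w] for the vector [w_k = U_jk * conj V_ik]. *)
pose T j i := \sum_k \sum_m (V i k * (V i m)^*) * (U j m * (U j k)^*) * C k m.
have T_ge0 j i : 0 <= T j i.
  have := C_psd (\col_k (U j k * (V i k)^* )); congr (_ <= _).
  rewrite mxE /T [RHS]exchange_big; apply: eq_bigr => m _; rewrite !mxE mulr_suml.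
  apply: eq_bigr => k _; rewrite !mxE rmorphM /= conjCK; ring.
(* Summing over [i] leaves only [m = k], by orthonormality of the columns of [V]; as [C k k = 1],
   the squared length of row [j] of [U] remains. [T_col] exchanges the two roles. *)
have T_row j : \sum_i T j i = 1.
  have := unitarymx_row_dot j j U1; rewrite eqxx mulr1n => <-.
  rewrite exchange_big /=; apply: eq_bigr => k _.
  rewrite exchange_big (bigD1 k) //= [X in _ + X]big1 ?addr0 => [|m mk].
    by rewrite -2!mulr_suml unitarymx_col_dot // eqxx mul1r Cii mulr1.
  by rewrite -2!mulr_suml unitarymx_col_dot // eq_sym (negPf mk) !mul0r.
have T_col i : \sum_j T j i = 1.
  have := unitarymx_row_dot i i V1; rewrite eqxx mulr1n => <-.
  rewrite exchange_big /=; apply: eq_bigr => k _.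
  rewrite exchange_big (bigD1 k) //= [X in _ + X]big1 ?addr0 => [|m mk].
    by rewrite -mulr_suml -mulr_sumr unitarymx_col_dot // eqxx mulr1 Cii mulr1.
  by rewrite -mulr_suml -mulr_sumr unitarymx_col_dot // (negPf mk) mulr0 mul0r.
(* Nonnegative elements of [R[i]] are real, so taking real parts loses nothing. *)
pose S : 'M[R]_n := \matrix_(j, i) complex.Re (T j i).
have SE j i : toC (S j i) = T j i by rewrite mxE RRe_real // ger0_real.
(* [mu 0 i] is the diagonal entry of [V *m K *m V ^t*]; expanding [H] inside [K] over its
   eigenvectors produces [T j i] as the coefficient of [l 0 j]. *)
have -> : mu = l *m map_mx toC S.
  apply/rowP => i.
  have diag_mu : diag_mx mu = V *m K *m V ^t*.
    rewrite [in RHS](orthomx_spectralP nK) -/mu -/V invmx_unitary //.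
    by rewrite !mulmxA (unitarymxP V1) mul1mx -mulmxA (unitarymxP V1) mulmx1.
  have -> : mu 0 i = (diag_mx mu) i i by rewrite !mxE eqxx.
  have HE k m : H k m = \sum_j l 0 j * (U j m * (U j k)^*).
    rewrite [in LHS](orthomx_spectralP nH) -/l -/U invmx_unitary // mxE.
    apply: eq_bigr => j _; rewrite mul_mx_diag !mxE; ring.
  rewrite diag_mu !mxE.
  under [RHS]eq_bigr => j _ do rewrite mxE SE mulr_sumr.
  rewrite [RHS]exchange_big /= [LHS](_ : _ = \sum_m \sum_k V i k * K k m * (V i m)^*).
    rewrite [LHS]exchange_big /=; apply: eq_bigr => k _.
    under [RHS]eq_bigr do rewrite mulr_sumr.
    rewrite [RHS]exchange_big /=; apply: eq_bigr => m _.
    rewrite mxE HE !mulr_suml mulr_sumr mulr_suml.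
    apply: eq_bigr => j _; ring.
  by apply: eq_bigr => m _; rewrite !mxE mulr_suml.
apply: ler_mxnorm_diag_doubly_stochastic.
- by move=> j i; rewrite -ler0c SE.
- move=> j; apply: (@complexI R); rewrite rmorph_sum rmorph1 -[RHS](T_row j).
  by apply: eq_bigr => i _; exact: SE.
- move=> i; apply: (@complexI R); rewrite rmorph_sum rmorph1 -[RHS](T_col i).
  by apply: eq_bigr => j _; exact: SE.
Qed.

Lemma ler_mxnorm_hadamard (n_gt0 : (0 < n)%N) (H Y : 'M[R[i]]_n) :
  H \is hermsymmx -> posdefmx Y -> N (hadamard H Y) <= max_diag n_gt0 Y * N H.
Proof.
move=> hH Y_posdef; have [hY Y_pos] := Y_posdef; set M := max_diag n_gt0 Y.
have Yii_gt0 := posdefmx_diag_gt0 _ Y_posdef.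
pose s i := Num.sqrt (complex.Re (Y i i)); pose d : 'rV[R]_n := \row_i s i.
have Re_gt0 i : 0 < complex.Re (Y i i) by have := Yii_gt0 i; rewrite ltcE => /andP[].
have s_gt0 i : 0 < s i by rewrite sqrtr_gt0.
have ss i : toC (s i) * toC (s i) = Y i i.
  by rewrite -rmorphM -expr2 sqr_sqrtr ?ltW //= RRe_real // gtr0_real.
have sN0 i : toC (s i) != 0 by rewrite gt_eqF // ltcR.
have dM i : `|d 0 i| <= Num.sqrt M.
  rewrite mxE gtr0_norm // ler_wsqrtr //; exact: le_bigmax_cond.
have M_gt0 : 0 < M := max_diag_gt0 n_gt0 Y_posdef.
have sM_gt0 : 0 < Num.sqrt M by rewrite sqrtr_gt0.
pose C : 'M[R[i]]_n := \matrix_(i, j) ((toC (s i))^-1 * Y i j * (toC (s j))^-1).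
pose D := diag_mx (map_mx toC d).
have -> : hadamard H Y = D *m (hadamard H C *m D).
  apply/matrixP => i j; rewrite mul_diag_mx mul_mx_diag !mxE.
  by field; rewrite !sN0.
apply: le_trans (ler_mxnorm_diagM d (Num.sqrt M) _ sM_gt0 dM) _.
(* [M] is split into two factors [Num.sqrt M], one for each [D]. *)
rewrite -[X in _ <= X * _](sqr_sqrtr (ltW M_gt0)) expr2 -mulrA ler_pM2l //.
apply: le_trans (ler_mxnorm_Mdiag d (Num.sqrt M) _ sM_gt0 dM) _.
rewrite ler_pM2l //; apply: ler_mxnorm_hadamard_correlation => //.
- apply/is_hermitianmxP; rewrite expr0 scale1r; apply/matrixP => i j.
  move/is_hermitianmxP: hY; rewrite expr0 scale1r => /matrixP/(_ i j).
  rewrite !mxE => ->; rewrite !rmorphM /= !fmorphV /= !conj_real_complex; ring.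
(* With [w' = D^-1 w], the form of [C] at [w] is that of [Y] at [w']; [w' = 0] is treated apart,
   since [Y_pos] concerns nonzero vectors. *)
- move=> w; pose w' := \col_i ((toC (s i))^-1 * w i 0).
  have -> : w ^t* *m C *m w = w' ^t* *m Y *m w'.
    apply/matrixP => a b; rewrite !ord1 !mxE; apply: eq_bigr => j _.
    rewrite !mxE !mulr_suml; apply: eq_bigr => i _.
    rewrite !mxE rmorphM /= fmorphV /= conj_real_complex; ring.
  have [->|w'N0] := eqVneq w' 0; first by rewrite mulmx0 mxE.
  exact/ltW/Y_pos.
- by move=> i; rewrite mxE -ss mulKf // mulfV.
Qed.

End UnitarilyInvariant.

(* From Hermitian parts to the generalized numerical radius *)
Local Close Scope sesquilinear_scope.

Theorem lemma2p6 (R : realType) (n : nat) (n_gt0 : (0 < n)%N)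
    (N : 'M[R[i]]_n -> R)
    (N_norm : is_mxnorm N)
    (N_mult : mxnorm_multiplicative N)
    (N_unitary : mxnorm_unitarily_invariant N)
    (N_selfadj : mxnorm_selfadjoint N)
    (X Y : 'M[R[i]]_n) (Y_posdef : posdefmx Y) :
  gen_num_radius N (hadamard X Y) <= max_diag n_gt0 Y * gen_num_radius N X.
Proof.
have [hY _] := Y_posdef.
apply: ge_sup => [|_ [t _ <-]].
  by have [] := gen_num_radius_has_sup (hadamard X Y) N_norm.
have -> : expi t *: hadamard X Y = hadamard (expi t *: X) Y.
  by apply/matrixP => i j; rewrite !mxE mulrA.
rewrite mxReal_part_hadamard //.
apply: le_trans (ler_mxnorm_hadamard N_norm N_unitary n_gt0 _ _
  (mxReal_part_hermitian _) Y_posdef) _.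
rewrite ler_wpM2l ?(ltW (max_diag_gt0 _ Y_posdef)) //.
(* The same angle [t] serves on both sides; boundedness makes the real supremum an upper bound. *)
apply: ub_le_sup; last by exists t.
by have [] := gen_num_radius_has_sup X N_norm.
Qed.
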